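(* Let $n$ be a positive integer and let $X=\{X_1,\dots,X_{n+2}\}$ be a set of $n+2$ cycles in $\mathbb{R}^n$. Suppose that for every $1\le i\le n+2$, $$Ap(X\setminus\{X_i\})=\{A_i,A_i'\},\qquad A_i\neq A_i'.$$ For $1\le i\le n+2$ let $T_i$ be the set of (oriented) hyperplanes tangent to both cycles $A_i$ and $A_i'$. Assume that the point $P_X$ is not a point at infinity, i.e. $p_{n+2}\ne 0$. Then there exists a sphere with center $P_X$ tangent to all hyperplanes in the sets $T_1,T_2,\dots,T_{n+2}$.
   Context: Let $V=\mathbb{R}^{n+3}$ with the symmetric bilinear form of signature $(n+1,2)$ $$(X|Y)=-x_1y_1+\sum_{i=2}^{n+1}x_iy_i+x_{n+2}y_{n+3}+x_{n+3}y_{n+2}.$$ Let $\mathbb{P}(V)$ be the projective space of $V$, and let $[X]$ be the class of a nonzero $X\in V$. The Lie quadric is $Q=\{[X]\in\mathbb{P}(V):(X|X)=0\}$. Cycles (oriented spheres, point spheres and oriented hyperplanes) in $\mathbb{R}^n$ are represented by points of $Q$. The point $[X]\in Q$ with $X=(r,c_1,\dots,c_n,v,w)$ represents the set $\{x\in\mathbb{R}^n: v|x|^2-2(c_1x_1+\dots+c_nx_n)-2w=0\}$, where $2vw=r^2-(c_1^2+\dots+c_n^2)$. If $v\ne0$ it is an oriented sphere with center $(c_1/v,\dots,c_n/v)$ and signed radius $r/v$; radius $0$ (a point sphere) is allowed and counts as a sphere. If $v=0$ it is an oriented hyperplane. A cycle is identified with the point of $Q$ representing it. Two cycles $[X],[Y]$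 are tangent iff $(X|Y)=0$ (oriented contact). For cycles $[Y_1],\dots,[Y_k]$ put $Ap([Y_1],\dots,[Y_k])=\{[X]\in Q:(X|Y_j)=0 \text{ for all } j\}$. The center of a cycle is the homogeneous point $[c_1:\dots:c_n:v]\in\mathbb{RP}^n$. The point $P_X$: choose $[P]=[p_1:\dots:p_{n+3}]\in\mathbb{P}(V)$ with $(P|X_i)=0$ for all $1\le i\le n+2$ (such a point exists). Then $P_X=[p_2:\dots:p_{n+1}:p_{n+2}]\in\mathbb{RP}^n$. It is a common point of the lines through the centers of the pairs $A_i,A_i'$, and for $p_{n+2}\neq0$ it is the point $(p_2/p_{n+2},\dots,p_{n+1}/p_{n+2})\in\mathbb{R}^n$. *)

(* Defs.v *)
From HB Require Import structures.
From mathcomp Require Import all_boot all_order all_algebra.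
From mathcomp Require Import boolp classical_sets reals.

Set Implicit Arguments.
Unset Strict Implicit.
Unset Printing Implicit Defensive.

Import Order.TTheory GRing.Theory Num.Theory.
Local Open Scope classical_set_scope.
Local Open Scope ring_scope.

(* P(W): a point [x] is the line spanned by a nonzero vector x. *)
Definition proj (R : realType) (W : vectType R) : Type :=
  {L : {vspace W} | \dim L == 1%N}.

Fact cls_subproof (R : realType) (W : vectType R) (x : W) (hx : x != 0) :
  \dim <[x]>%VS == 1%N.
Proof. by rewrite dim_vline hx. Qed.

Definition cls (R : realType) (W : vectType R) (x : W) (hx : x != 0) : proj W :=
  exist _ <[x]>%VS (cls_subproof hx).

(* A chosen nonzero representative; the notions below do not depend on the
   choice (see orth_cls, hyperplane_cls, sphere_cls, center_cls). *)
Definition rep (R : realType) (W : vectType R) (L : proj W) : W :=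
  vpick (val L).

(* The k-th homogeneous coordinate, counted from k = 1. *)
Definition hc (R : realType) (m : nat) (x : 'rV[R]_m.+1) (k : nat) : R :=
  x ord0 (inord k.-1).

Definition lie_form (R : realType) (n : nat) (x y : 'rV[R]_n.+3) : R :=
  - (hc x 1 * hc y 1) + \sum_(2 <= i < n.+2) hc x i * hc y i
  + hc x n.+2 * hc y n.+3 + hc x n.+3 * hc y n.+2.

Definition PV (R : realType) (n : nat) : Type := proj 'rV[R]_n.+3.

Definition orth (R : realType) (n : nat) (L M : PV R n) : Prop :=
  lie_form (rep L) (rep M) = 0.

(* The Lie quadric; its points are the cycles of R^n. *)
Definition lie_quadric (R : realType) (n : nat) : set (PV R n) :=
  [set L | orth L L].

(* In coordinates (r, c_1, ..., c_n, v, w), v is the coordinate n + 2. *)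
Definition is_sphere (R : realType) (n : nat) (L : PV R n) : Prop :=
  lie_quadric L /\ hc (rep L) n.+2 != 0.

Definition is_hyperplane (R : realType) (n : nat) (L : PV R n) : Prop :=
  lie_quadric L /\ hc (rep L) n.+2 = 0.

Definition tangent (R : realType) (n : nat) (L M : PV R n) : Prop := orth L M.

Definition Ap (R : realType) (n : nat) (Y : set (PV R n)) : set (PV R n) :=
  [set L | lie_quadric L /\ forall M, Y M -> orth L M].

(* (r, c_1, ..., c_n, v, w) |-> (c_1, ..., c_n, v) *)
Definition center_vec (R : realType) (n : nat) (x : 'rV[R]_n.+3) :
  'rV[R]_n.+1 := \row_(i < n.+1) hc x i.+2.

(* The homogeneous point [x_2 : ... : x_(n+2)], as a line of R^(n+1). It is the
   center when L is a cycle. When all these coordinates vanish there is no such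
   point, and the value is the zero subspace. *)
Definition center (R : realType) (n : nat) (L : PV R n) :
  {vspace 'rV[R]_n.+1} := <[center_vec (rep L)]>%VS.

Definition common_tangent_hyperplanes (R : realType) (n : nat)
    (A B : PV R n) : set (PV R n) :=
  [set H | [/\ is_hyperplane H, tangent H A & tangent H B]].

Section Representatives.
Variable R : realType.

Lemma rep_cls (W : vectType R) (x : W) (hx : x != 0) :
  exists2 a : R, a != 0 & rep (cls hx) = a *: x.
Proof.
have /vlineP[a ha] : rep (cls hx) \in <[x]>%VS by exact: memv_pick.
exists a => //; apply/eqP => a0.
have : rep (cls hx) == 0 by rewrite ha a0 scale0r.
by rewrite vpick0 /= -dimv_eq0 dim_vline hx.
Qed.

Variable n : nat.
Implicit Types x y : 'rV[R]_n.+3.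

Lemma hcZ (a : R) x k : hc (a *: x) k = a * hc x k.
Proof. by rewrite /hc mxE. Qed.

Lemma lie_formZ (a b : R) x y :
  lie_form (a *: x) (b *: y) = a * b * lie_form x y.
Proof.
rewrite /lie_form !hcZ !mulrDr mulrN !(mulrACA a _ b); congr (_ + _ + _ + _).
by rewrite mulr_sumr; apply: eq_bigr => i _; rewrite !hcZ mulrACA.
Qed.

Lemma orth_cls x y (hx : x != 0) (hy : y != 0) :
  orth (cls hx) (cls hy) <-> lie_form x y = 0.
Proof.
rewrite /orth; have [a a0 ->] := rep_cls hx; have [b b0 ->] := rep_cls hy.
rewrite lie_formZ; split=> [/eqP|->]; last by rewrite mulr0.
by rewrite !mulf_eq0 (negPf a0) (negPf b0) => /eqP.
Qed.

Lemma hyperplane_cls x (hx : x != 0) :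
  is_hyperplane (cls hx) <-> lie_form x x = 0 /\ hc x n.+2 = 0.
Proof.
have [a a0 e] := rep_cls hx; rewrite /is_hyperplane e hcZ.
split=> -[q v].
  split; first by apply/(orth_cls hx hx).
  by apply/eqP; move/eqP: v; rewrite mulf_eq0 (negPf a0).
by split; [apply/(orth_cls hx hx) | rewrite v mulr0].
Qed.

Lemma sphere_cls x (hx : x != 0) :
  is_sphere (cls hx) <-> lie_form x x = 0 /\ hc x n.+2 != 0.
Proof.
have [a a0 e] := rep_cls hx; rewrite /is_sphere e hcZ mulf_eq0 (negPf a0) /=.
by split=> -[q v]; split=> //; apply/(orth_cls hx hx).
Qed.

Lemma center_cls x (hx : x != 0) :
  center (cls hx) = <[center_vec x]>%VS.
Proof.
have [a a0 e] := rep_cls hx; rewrite /center e.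
have -> : center_vec (a *: x) = a *: center_vec x.
  by apply/rowP => i; rewrite !mxE hcZ.
apply/eqP; rewrite eqEsubv -!memvE memvZ ?memv_line //=.
by apply/vlineP; exists a^-1; rewrite scalerA mulVf // scale1r.
Qed.

End Representatives.

(* Main.v *)
(* Any P orthogonal to X_1, ..., X_(n+2) lies in the span of A_i and A_i'.
   Hence a hyperplane H tangent to A_i and A_i' is orthogonal to P.  As the
   coordinate n + 2 of H vanishes, changing the last coordinate of P does not
   affect (P | H), and since p_(n+2) <> 0 it can be chosen so that P becomes
   isotropic: the result is the sphere S. *)
Require Import Defs.
From HB Require Import structures.
From mathcomp Require Import all_boot all_order all_algebra.
From mathcomp Require Import boolp classical_sets reals.
From mathcomp Require Import ring.

Set Implicit Arguments.
Unset Strict Implicit.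
Unset Printing Implicit Defensive.

Import Order.TTheory GRing.Theory Num.Theory.
Local Open Scope classical_set_scope.
Local Open Scope ring_scope.

Section LieForm.
Variables (R : realType) (n : nat).
Implicit Types (x y z : 'rV[R]_n.+3) (L M : PV R n).

Lemma lie_formC x y : lie_form x y = lie_form y x.
Proof.
rewrite /lie_form (eq_bigr (fun i => hc y i * hc x i)).
  by ring.
by move=> i _; rewrite mulrC.
Qed.

Lemma hcD x y k : hc (x + y) k = hc x k + hc y k.
Proof. by rewrite /hc mxE. Qed.

Lemma lie_formDl x y z : lie_form (x + y) z = lie_form x z + lie_form y z.
Proof.
rewrite /lie_form (eq_bigr (fun i => hc x i * hc z i + hc y i * hc z i)).
  by rewrite big_split /= !hcD; ring.
by move=> i _; rewrite hcD mulrDl.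
Qed.

Lemma lie_formDr x y z : lie_form x (y + z) = lie_form x y + lie_form x z.
Proof. by rewrite !(lie_formC x) lie_formDl. Qed.

Lemma lie_formZl (a : R) x y : lie_form (a *: x) y = a * lie_form x y.
Proof. by rewrite -{1}(scale1r y) lie_formZ mulr1. Qed.

Lemma lie_formZr (a : R) x y : lie_form x (a *: y) = a * lie_form x y.
Proof. by rewrite lie_formC lie_formZl lie_formC. Qed.

Definition lie_form_lin := (lie_formDl, lie_formDr, lie_formZl, lie_formZr).

Lemma hc_delta_max_eq0 k : (k < n.+3)%N ->
  hc (delta_mx 0 ord_max : 'rV[R]_n.+3) k = 0.
Proof.
move=> lt_k; have lt_k1 : (k.-1 < n.+2)%N by case: k lt_k.
by rewrite /hc mxE -[X in _ && X]val_eqE /= inordK ?(ltn_eqF lt_k1) ?andbF // ltnW.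
Qed.

(** The last basis vector pairs only with the coordinate $v$. It is therefore isotropic, and among
    cycles it is orthogonal exactly to those with $v=0$, the hyperplanes. *)
Lemma lie_form_delta_maxl x : lie_form (delta_mx 0 ord_max) x = hc x n.+2.
Proof.
rewrite /lie_form big_nat big1 => [|i /andP[_ ilt]].
  2: by rewrite hc_delta_max_eq0 ?mul0r // ltnW.
rewrite (@hc_delta_max_eq0 1) // (@hc_delta_max_eq0 n.+2) // !mul0r oppr0 !add0r {1}/hc mxE.
rewrite -[X in _ && X]val_eqE /=.
by rewrite inordK // !eqxx mul1r.
Qed.

Lemma rep_neq0 L : rep L != 0.
Proof. by rewrite /rep vpick0 -dimv_eq0 (eqP (valP L)). Qed.

Lemma proj_line L : val L = <[rep L]>%VS.
Proof.
apply/eqP; rewrite eq_sym eqEdim -memvE memv_pick /=.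
by rewrite (eqP (valP L)) dim_vline rep_neq0.
Qed.

(** One line contains the other and both have dimension 1; [k] is nonzero because [rep L] is. *)
Lemma proj_ext L M (k : R) : rep L = k *: rep M -> L = M.
Proof.
move=> e; apply: val_inj; apply/eqP; rewrite eqEdim.
rewrite (eqP (valP L)) (eqP (valP M)) leqnn andbT !proj_line -memvE e.
by rewrite memvZ // memv_line.
Qed.

Lemma rep_of_cls x (hx : x != 0) L : cls hx = L ->
  exists k : R, x = k *: rep L.
Proof. by move=> <-; apply/vlineP; rewrite -proj_line memv_line. Qed.

Lemma orth_clsl x (hx : x != 0) L : lie_form x (rep L) = 0 -> orth (cls hx) L.
Proof.
by rewrite /orth; have [a _ ->] := rep_cls hx => h; rewrite lie_formZl h mulr0.
Qed.

Lemma Ap_cls (Y : set (PV R n)) x (hx : x != 0) : lie_form x x = 0 ->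
  (forall M, Y M -> lie_form x (rep M) = 0) -> Ap Y (cls hx).
Proof.
by move=> xx xY; split=> [|M YM]; [apply/orth_cls|apply/orth_clsl/xY].
Qed.

Section TwoPoints.
Variables (Y : set (PV R n)) (A A' : PV R n).
Hypotheses (ApY : Ap Y = [set A; A']) (neqA : A <> A').

(** Otherwise the whole projective line through [A] and [A'] would consist of cycles in [Ap Y], and
    the sum of the two representatives would give a third point. *)
Lemma Ap_pair_form_neq0 : lie_form (rep A) (rep A') != 0.
Proof.
have [AA AY] : Ap Y A by rewrite ApY; left.
have [AA' AY'] : Ap Y A' by rewrite ApY; right.
apply/eqP => g0.
have y0 : rep A + rep A' != 0.
  apply/eqP => /eqP; rewrite addr_eq0 -scaleN1r => /eqP e.
  exact: neqA (proj_ext e).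
have : Ap Y (cls y0).
  apply: Ap_cls => [|M YM]; rewrite !lie_form_lin.
    by rewrite (lie_formC (rep A') (rep A)) AA AA' g0 !addr0.
  by rewrite AY // AY' // addr0.
(* If the sum is a multiple of one representative, then so is the other summand, which forces
   [A = A']. *)
rewrite ApY => -[] /rep_of_cls[k /eqP].
  rewrite addrC eq_sym -subr_eq -[X in _ - X]scale1r -scalerBl => /eqP e.
  exact: neqA (esym (proj_ext (esym e))).
rewrite eq_sym -subr_eq -[X in _ - X]scale1r -scalerBl => /eqP e.
exact: neqA (proj_ext (esym e)).
Qed.

(* With w the component of p orthogonal to A and A', some A + t A' + w is
   isotropic, and it is a third point of Ap Y unless w = 0. *)
Lemma Ap_pair_span p : (forall M, Y M -> lie_form p (rep M) = 0) ->
  exists a b : R, p = a *: rep A + b *: rep A'.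
Proof.
move=> pY.
have [AA AY] : Ap Y A by rewrite ApY; left.
have [AA' AY'] : Ap Y A' by rewrite ApY; right.
rewrite /orth in AA AA'.
have g0 := Ap_pair_form_neq0.
set x := rep A in AA g0 *; set x' := rep A' in AA' g0 *.
set g := lie_form x x' in g0.
have gC : lie_form x' x = g by rewrite lie_formC.
(* Since [x] and [x'] are isotropic, the coefficient along [x] is read off by pairing with [x'], and
   conversely. *)
pose a := lie_form p x' / g; pose b := lie_form p x / g.
pose w := p + (- a) *: x + (- b) *: x'.
have wx : lie_form w x = 0.
  by rewrite /w !lie_form_lin AA gC /b; field.
have wx' : lie_form w x' = 0.
  by rewrite /w !lie_form_lin AA' -/g /a; field.
have wY M : Y M -> lie_form w (rep M) = 0.
  by move=> YM; rewrite /w !lie_form_lin pY // (AY M YM) (AY' M YM); ring.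
have pE : p = a *: x + b *: x' + w.
  by rewrite /w !scaleNr -[p - _ - _]addrA -opprD [RHS]addrC subrK.
(* This [t] solves $(y|y)=2tg+(w|w)=0$ for the vector [y] below. *)
clearbody w; pose t := - lie_form w w / (2 * g).
pose y := x + t *: x' + w.
have yx' : lie_form y x' = g by rewrite /y !lie_form_lin AA' wx' -/g; ring.
have yx : lie_form y x = t * g by rewrite /y !lie_form_lin AA wx gC; ring.
have y0 : y != 0.
  apply/eqP => e; move: yx'; rewrite e -(scale0r x) lie_formZl mul0r => /esym/eqP.
  by rewrite (negPf g0).
have w0 : w = 0.
  have : Ap Y (cls y0).
    apply: Ap_cls => [|M YM].
      rewrite {2}/y !lie_formDr lie_formZr yx yx' /y !lie_formDl lie_formZl.
      by rewrite (lie_formC x w) (lie_formC x' w) wx wx' /t; field.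
    by rewrite /y !lie_form_lin (AY M YM) (AY' M YM) wY //; ring.
  (* If [y = k *: x], pairing with [x] and [x'] gives [t = 0] and [k = 1], so [w = 0]. If
     [y = k *: x'], pairing with [x'] gives [g = 0], a contradiction. *)
  rewrite ApY => -[] /rep_of_cls[k yk]; rewrite -/x -/x' in yk.
    have t0 : t = 0.
      by apply: (mulIf g0); rewrite mul0r -yx yk lie_formZl AA mulr0.
    have k1 : k = 1 by apply: (mulIf g0); rewrite mul1r -{2}yx' yk lie_formZl.
    by move: yk; rewrite /y t0 k1 scale0r addr0 scale1r -{2}[x]addr0 => /addrI.
  by move: g0; rewrite -yx' yk lie_formZl AA' mulr0 eqxx.
by exists a, b; rewrite pE w0 addr0.
Qed.

Lemma tangent_pair_orth p H : (forall M, Y M -> lie_form p (rep M) = 0) ->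
  tangent H A -> tangent H A' -> lie_form p (rep H) = 0.
Proof.
move=> /Ap_pair_span[a [b ->]] HA HA'.
by rewrite !lie_form_lin !(lie_formC _ (rep H)) HA HA' !mulr0 addr0.
Qed.

End TwoPoints.

End LieForm.

Theorem theorem3p6 (R : realType) (n : nat) (n_gt0 : (0 < n)%N)
    (X A A' : 'I_n.+2 -> PV R n)
    (X_cycle : forall i, lie_quadric (X i))
    (X_inj : injective X)
    (ApX : forall i, Ap (range X `\ X i) = [set A i; A' i])
    (A_neq : forall i, A i <> A' i)
    (P : PV R n)
    (P_orth : forall i, orth P (X i))
    (P_finite : hc (rep P) n.+2 != 0) :
  exists S : PV R n,
    [/\ is_sphere S,
        center S = center P
      & forall i H, common_tangent_hyperplanes (A i) (A' i) H -> tangent S H].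
Proof.
set p := rep P in P_finite *.
pose e : 'rV[R]_n.+3 := delta_mx 0 ord_max.
(* As [e] is isotropic, $(p+te|p+te)=(p|p)+2t\,p_{n+2}$, which vanishes for this [t]. *)
pose t := - lie_form p p / (2 * hc p n.+2).
pose s := p + t *: e.
have sv : hc s n.+2 = hc p n.+2 by rewrite hcD hcZ hc_delta_max_eq0 ?ltnSn // mulr0 addr0.
have s0 : s != 0.
  apply: contraNneq P_finite => s0.
  by rewrite -sv s0 /hc mxE.
have ss : lie_form s s = 0.
  rewrite /s !lie_form_lin (lie_formC p e) !lie_form_delta_maxl hc_delta_max_eq0 ?ltnSn //.
  by rewrite /t; field.
exists (cls s0); split.
- by apply/sphere_cls; rewrite sv.
(* The center omits the last coordinate, the only one in which [s] and [p] differ. *)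
- rewrite center_cls /center -/p; suff -> : center_vec s = center_vec p by [].
  by apply/rowP => i; rewrite !mxE hcD hcZ hc_delta_max_eq0 ?mulr0 ?addr0 ?ltnS ?leq_ord.
- move=> i H [[_ Hv] HA HA'].
  apply: orth_clsl; rewrite /s lie_formDl lie_formZl lie_form_delta_maxl Hv mulr0 addr0.
  by apply: (tangent_pair_orth (ApX i) _ _ HA HA') => // M [[j _ <-] _]; apply: P_orth.
Qed.
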